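(* Every commutative doppelsemigroup $(D,\dashv,\vdash)$ is strong.
   Context: A doppelsemigroup $(D,\dashv,\vdash)$ is a set $D$ with two associative binary operations $\dashv,\vdash$ satisfying $(x\dashv y)\vdash z=x\dashv(y\vdash z)$ and $(x\vdash y)\dashv z=x\vdash(y\dashv z)$ for all $x,y,z\in D$. It is commutative if both $\dashv$ and $\vdash$ are commutative; strong if $x\dashv(y\vdash z)=x\vdash(y\dashv z)$ for all $x,y,z\in D$. *)

(* Defs.v *)
From mathcomp Require Import ssreflect ssrfun.

Set Implicit Arguments.
Unset Strict Implicit.
Unset Printing Implicit Defensive.

Declare Scope doppel_scope.
Delimit Scope doppel_scope with doppel.

Record doppelsemigroup : Type := Doppelsemigroup {
  carrier :> Type;
  dashv : carrier -> carrier -> carrier;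
  vdash : carrier -> carrier -> carrier;
  dashvA : associative dashv;
  vdashA : associative vdash;
  dashv_vdashA : forall x y z : carrier,
    vdash (dashv x y) z = dashv x (vdash y z);
  vdash_dashvA : forall x y z : carrier,
    dashv (vdash x y) z = vdash x (dashv y z)
}.

Notation "x ⊣ y" := (dashv x y)
  (at level 40, no associativity) : doppel_scope.
Notation "x ⊢ y" := (vdash x y)
  (at level 40, no associativity) : doppel_scope.

Local Open Scope doppel_scope.

Definition doppel_commutative (D : doppelsemigroup) : Prop :=
  commutative (@dashv D) /\ commutative (@vdash D).

Definition doppel_strong (D : doppelsemigroup) : Prop :=
  forall x y z : D, x ⊣ (y ⊢ z) = x ⊢ (y ⊣ z).

(* Main.v *)
Require Import Defs.
From mathcomp Require Import ssreflect ssrfun.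

Local Open Scope doppel_scope.

(** The mixed associativity laws let two adjacent products be rebracketed while
    the operations keep their places. Commutativity of ⊢ moves [z] from the
    right end of [(x ⊣ y) ⊢ z] to the left end of [z ⊢ (x ⊣ y)], and this is
    what exchanges the order of the operations:
    [x ⊣ (y ⊢ z) = (x ⊣ y) ⊢ z = z ⊢ (x ⊣ y) = (z ⊢ x) ⊣ y = (x ⊢ z) ⊣ y
     = x ⊢ (z ⊣ y) = x ⊢ (y ⊣ z)]. *)
Theorem proposition3p2 (D : doppelsemigroup) :
  doppel_commutative D -> doppel_strong D.
Proof.
move=> [dashvC vdashC] x y z.
by rewrite -dashv_vdashA vdashC -vdash_dashvA (vdashC z x) vdash_dashvA (dashvC z y).
Qed.
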